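(* Let $|t|<1$. Then the multivariable hypergeometric function ${}^{(k)}E^{(r)}$ satisfies $$\sum_{n=0}^{\infty}{}^{(k)}E^{(r)}\left(-n,\beta_{k+1},\dots,\beta_r;\gamma_1,\dots,\gamma_r;x_1,\dots,x_r\right)\frac{t^n}{n!}$$ $$=e^{t}\,{}_0F_1\left(-;\gamma_1;x_1(-t)^{\rho}\right)\cdots{}_0F_1\left(-;\gamma_k;x_k(-t)^{\rho}\right)\,\Phi\left(\beta_{k+1};\gamma_{k+1};-x_{k+1}t\right)\cdots\Phi\left(\beta_r;\gamma_r;-x_rt\right).$$
   Context: The Pochhammer symbol is $(\lambda)_\nu=\Gamma(\lambda+\nu)/\Gamma(\lambda)$ for $\lambda\in\mathbb{C}\setminus\{0,-1,-2,\dots\}$; moreover $(\lambda)_0=1$ and $(\lambda)_n=\lambda(\lambda+1)\cdots(\lambda+n-1)$ for every positive integer $n$ and every $\lambda\in\mathbb{C}$. (In particular, a symbol $(-n)_\nu$ with $n$ a nonnegative integer is defined only for nonnegative integers $\nu$.) Let $r\ge 1$ and $0\le k\le r$ be integers and $\rho\ge 0$. The multivariable hypergeometric function ${}^{(k)}E^{(r)}$ (depending on $\rho$) with complex parameters $\alpha,\beta_{k+1},\dots,\beta_r,\gamma_1,\dots,\gamma_r$ and complex variables $x_1,\dots,x_r$ is $${}^{(k)}E^{(r)}(\alpha,\beta_{k+1},\dots,\beta_r;\gamma_1,\dots,\gamma_r;x_1,\dots,x_r):=\sum_{m_1,\dots,m_r=0}^{\infty}(\alpha)_{\rho(m_1+\dots+m_k)+m_{k+1}+\dots+m_r}\frac{(\beta_{k+1})_{m_{k+1}}\cdots(\beta_r)_{m_r}}{(\gamma_1)_{m_1}\cdots(\gamma_r)_{m_r}}\frac{x_1^{m_1}}{m_1!}\cdots\frac{x_r^{m_r}}{m_r!},$$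 where $\rho(\sqrt{|x_1|}+\dots+\sqrt{|x_k|})+|x_{k+1}|+\dots+|x_r|<1$. Identities are understood for parameters and variables for which the functions occurring in them are defined (Pochhammer symbols defined, denominators nonzero, arguments satisfying this condition, defining series convergent). Here ${}_0F_1(-;\gamma;z)=\sum_{n=0}^\infty \frac{z^n}{(\gamma)_n\,n!}$ and $\Phi(\beta;\gamma;z)={}_1F_1(\beta;\gamma;z)=\sum_{n=0}^\infty\frac{(\beta)_n}{(\gamma)_n}\frac{z^n}{n!}$ is the confluent hypergeometric function. *)

(* Defs.v *)
From mathcomp Require Import all_boot all_order all_algebra.
From mathcomp Require Import all_classical all_reals all_analysis.
From mathcomp.analysis.showcase Require Import summability.
From mathcomp.real_closed Require Import complex.

Set Implicit Arguments.
Unset Strict Implicit.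
Unset Printing Implicit Defensive.

Import Order.TTheory GRing.Theory Num.Theory numFieldNormedType.Exports.

Local Open Scope classical_set_scope.
Local Open Scope ring_scope.
Local Open Scope complex_scope.

(* [R[i]] packaged as a numClosedFieldType: the norm topology is inferred from
   an instance of a numeric field, not from the bare carrier [R[i]]. *)
Definition Cplx (R : realType) : numClosedFieldType := R[i].

Section Defs.
Variable R : realType.
Notation C := (Cplx R).

(* Same power series as [expR]. *)
Definition expC (z : C) : C :=
  limn (series (fun n : nat => z ^+ n / n`!%:R : C)).

(* Principal argument, in ]-pi, pi]; its value at 0 is irrelevant. *)
Definition argC (z : C) : R :=
  let a := acos (complex.Re z / complex.Re `|z|) in
  if 0 <= complex.Im z then a else - a.

Definition logC (z : C) : C := ln (complex.Re `|z|) +i* argC z.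

(* z ^ rho, by repeated multiplication when rho is a natural number (so
   0 ^ 0 = 1), and on the principal branch otherwise. *)
Definition powC (z : C) (rho : R) : C :=
  if rho \is a Num.nat then z ^+ Num.truncn rho
  else if z == 0 then 0 else expC (rho%:C * logC z).

(* Gauss's limit for the Gamma function; meaningful when z is not one of the
   poles 0, -1, -2, ... *)
Definition GammaC (z : C) : C :=
  limn (fun n : nat =>
    n`!%:R * expC ((ln (n%:R : R))%:C * z) / \prod_(j < n.+1) (z + j%:R) : C).

Definition pochn (lam : C) (n : nat) : C := \prod_(j < n) (lam + j%:R).

(* The Pochhammer symbol for a real increment nu; junk unless
   [poch_defined lam nu]. *)
Definition poch (lam : C) (nu : R) : C :=
  if nu \is a Num.nat then pochn lam (Num.truncn nu)
  else GammaC (lam + nu%:C) / GammaC lam.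

Definition poch_defined (lam : C) (nu : R) : Prop :=
  nu \is a Num.nat \/
  (forall n : nat, lam <> - n%:R) /\ (forall n : nat, lam + nu%:C <> - n%:R).

Definition hyp0F1 (c z : C) : C :=
  limn (series (fun n : nat => z ^+ n / (pochn c n * n`!%:R) : C)).

Definition Phi (b c z : C) : C :=
  limn (series (fun n : nat => pochn b n / pochn c n * (z ^+ n / n`!%:R) : C)).

Section E.
(* Indices are shifted by one: i : 'I_r stands for i+1 in {1, ..., r}, and
   (i < k) selects the first k variables.  Only the entries b i with k <= i
   are ever used. *)
Variables (rho : R) (r k : nat) (a : C) (b c x : 'I_r -> C).

Definition E_exponent (m : {ffun 'I_r -> nat}) : R :=
  rho * (\sum_(i < r | (i < k)%N) m i)%:R + (\sum_(i < r | (k <= i)%N) m i)%:R.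

Definition E_term (m : {ffun 'I_r -> nat}) : C :=
  poch a (E_exponent m)
  * (\prod_(i < r | (k <= i)%N) pochn (b i) (m i) / \prod_(i < r) pochn (c i) (m i))
  * \prod_(i < r) (x i ^+ m i / (m i)`!%:R).

(* The r-fold series is summed along the net of finite sets of multi-indices. *)
Definition E_fun : C := sum E_term.

(* The order of [Cplx R] compares real elements as in R. *)
Definition E_region : Prop :=
  rho%:C * (\sum_(i < r | (i < k)%N) sqrtC `|x i|)
  + \sum_(i < r | (k <= i)%N) `|x i| < 1.

Definition E_defined : Prop :=
  [/\ forall m, poch_defined a (E_exponent m),
      forall i n, pochn (c i) n != 0,
      E_region &
      cvg (partial_sum E_term @ totally)].

End E.
End Defs.

(* Main.v *)
Require Import Defs.
From mathcomp Require Import all_boot all_order all_algebra finmap.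
From mathcomp Require Import all_classical all_reals all_analysis.
From mathcomp.analysis.showcase Require Import summability.
From mathcomp.real_closed Require Import complex.
From mathcomp Require Import ring zify.

Set Implicit Arguments.
Unset Strict Implicit.
Unset Printing Implicit Defensive.

Import Order.TTheory GRing.Theory Num.Theory numFieldNormedType.Exports.

Local Open Scope classical_set_scope.
Local Open Scope ring_scope.

(** For a nonnegative integer [n], the symbol [(-n)_nu] is defined only when
    [nu] is a natural number.  So if some variable belongs to the first group
    ([k > 0]), the hypothesis forces [rho] to be a natural number, and every
    exponent occurring in the multiple series is a natural number [d m]
    ([E_defined_rho_nat], [E_exponent_nat]).

    Since [(-n)_d / n!] is [(-1)^d / (n - d)!] for [d <= n], and [0] otherwise,
    the terms of a fixed multi-index [m] in the functions of index [j < n],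
    weighted by [t^j / j!], sum up to [G m * e_(n - d m)(t)] ([sum_E_term]).
    Here [e_p] is the sum of the first [p] terms of the exponential series (so
    [0] for [n <= d m], with truncated subtraction), and [G m] is the product
    over [i] of the [m i]-th terms of the one-variable series on the right-hand
    side.  The theorem is therefore the interchange of the limits in the number
    [n] of summed functions and in the multi-index [m].

    The interchange is Tannery's argument ([tannery]): the factors [e_p(t)] are
    bounded and tend to [e^t], and the family [G] is absolutely summable.  The
    multi-indices are exhausted by the boxes [{m | m i < L for all i}], over
    which the sum of a product of one-variable terms is the product of the
    one-variable partial sums ([sum_box_prod]); this gives at once the limit of
    the sums of [G] and their absolute summability.  The one-variable series
    are absolutely summable by the ratio test ([hyp_abs_summable]), and
    absolute summability implies convergence because bounded monotone sequences
    of complex numbers converge ([Cplx_monotone_complete]). *)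

(** * Absolutely summable series *)

(** The order of a numeric closed field compares two numbers only when they
    have the same imaginary part, so this is the completeness of the real line,
    stated without leaving the field.  It replaces Cauchy completeness in the
    passage from absolute summability to convergence. *)
Definition monotone_complete (C : numClosedFieldType) : Prop :=
  forall (u : nat -> C) (M : C),
  (forall n, u n <= u n.+1) -> (forall n, u n <= M) -> cvgn u.

Section AbsoluteConvergence.
Variable C : numClosedFieldType.

Definition abs_summable (f : nat -> C) : Prop :=
  exists M, forall n, series (fun j => `|f j| : C) n <= M.

Hypothesis C_complete : monotone_complete C.

Lemma abs_summable_norm_cvg f :
  abs_summable f -> cvgn (series (fun j => `|f j| : C)).
Proof.
case=> M f_le; apply: C_complete f_le => n.
by rewrite seriesSr lerDl.
Qed.

(** A real series dominated by a convergent series of nonnegative terms: adding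
    the dominating series makes the partial sums monotone. *)
Lemma real_series_cvg (f g : nat -> C) :
  (forall n, - g n <= f n <= g n) -> cvgn (series g) ->
  (exists M, forall n, series g n <= M) -> cvgn (series f).
Proof.
move=> f_g g_cvg [M g_le].
pose h n : C := f n + g n.
have hE n : series h n = series f n + series g n.
  by rewrite /series /= big_split.
have h_cvg : cvgn (series h).
  apply: (@C_complete _ (M + M)) => n.
    by rewrite seriesSr lerDl /h -lerBlDr sub0r; case/andP: (f_g n).
  rewrite hE (le_trans _ (lerD (g_le n) (g_le n))) // lerD2r ler_sum // => i _.
  by case/andP: (f_g i).
have -> : series f = (fun n => series h n - series g n).
  by apply/funext => n; rewrite hE addrK.
exact: is_cvgB.
Qed.

Lemma abs_summable_cvg f : abs_summable f -> cvgn (series f).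
Proof.
move=> f_sum; have nf_cvg := abs_summable_norm_cvg f_sum.
have Re_cvg : cvgn (series (fun n => 'Re (f n) : C)).
  apply: real_series_cvg nf_cvg f_sum => n.
  by rewrite -real_ler_norml ?Creal_Re // leif_normC_Re_Creal.
have Im_cvg : cvgn (series (fun n => 'Im (f n) : C)).
  apply: real_series_cvg nf_cvg f_sum => n.
  rewrite -real_ler_norml ?Creal_Im // -(normrN ('Im _)) -ReMil.
  by rewrite (le_trans (leif_normC_Re_Creal _)) // normrM normCi mul1r.
have -> : series f = (fun n => series (fun n => 'Re (f n) : C) n
                         + 'i * series (fun n => 'Im (f n) : C) n).
  apply/funext => n; rewrite /series /= mulr_sumr -big_split /=.
  by apply: eq_bigr => i _; rewrite [LHS]Crect.
by apply: is_cvgD => //; apply: is_cvgMl_tmp.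
Qed.

(** From rank [N] on, the partial sum plus twice the current term does not
    increase, whence the bound. *)
Lemma ratio_abs_summable f (N : nat) :
  (forall n, (N <= n)%N -> `|f n.+1| *+ 2 <= `|f n|) -> abs_summable f.
Proof.
move=> f_ratio; set S := series (fun j => `|f j| : C).
exists (S N + `|f N| *+ 2) => n; rewrite -/(S n).
have [n_le|N_lt] := leqP n N.
  apply: (@le_trans _ _ (S N)); last by rewrite lerDl mulrn_wge0.
  by rewrite -subr_ge0 sub_series n_le sumr_ge0.
apply: (@le_trans _ _ (S n + `|f n| *+ 2)); first by rewrite lerDl mulrn_wge0.
rewrite -(subnKC (ltnW N_lt)); elim: (n - N)%N => [|d]; first by rewrite addn0.
apply: le_trans; rewrite addnS /S seriesSr -addrA lerD2l mulr2n lerD2l.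
by apply: f_ratio; rewrite leq_addr.
Qed.

End AbsoluteConvergence.

(** * Series of complex numbers *)

Section ComplexNumbers.
Variable R : realType.
Notation C := (Cplx R).

Lemma Cplx_monotone_complete : monotone_complete C.
Proof.
move=> u M u_incr u_le.
pose v n : R := complex.Re (u n).
have v_incr : {homo v : n m / (n <= m)%N >-> n <= m}.
  apply/nondecreasing_seqP => n.
  by have := u_incr n; rewrite lecE => /andP[].
have v_cvg : cvgn v.
  apply: nondecreasing_is_cvgn => //; exists (complex.Re M) => _ [n _ <-].
  by have := u_le n; rewrite lecE => /andP[].
have uE n : u n = Complex (v n) (complex.Im (u 0)).
  have <- : complex.Im (u n) = complex.Im (u 0).
    elim: n => // n <-.
    by have := u_incr n; rewrite lecE => /andP[/eqP].
  by rewrite /v; case: (u n).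
pose l : C := Complex (limn v) (complex.Im (u 0)).
apply/cvg_ex; exists l; apply/cvgrPdist_le => eps eps_gt0.
have [e e_gt0 epsE] : exists2 e : R, 0 < e & eps = e%:C%C.
  move: eps_gt0; rewrite ltcE; case: (eps) => a b /= /andP[/eqP -> a_gt0].
  by exists a.
move/cvgrPdist_le: v_cvg => /(_ e e_gt0).
apply: filterS => n v_near.
have -> : l - u n = (limn v - v n)%:C%C.
  by rewrite uE /l /GRing.add /= subrr.
by rewrite epsE normc_def /= expr0n addr0 sqrtr_sqr lecR.
Qed.

Lemma Cplx_archi (z : C) : exists K : nat, `|z| <= K%:R.
Proof.
exists (Num.truncn (complex.Re `|z|)).+1.
have -> : `|z| = (complex.Re `|z|)%:C%C by rewrite normc_def.
by rewrite -(rmorph_nat (real_complex R)) lecR ltW // truncnS_gt.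
Qed.

Lemma pochnS (b : C) n : pochn b n.+1 = pochn b n * (b + n%:R).
Proof. by rewrite /pochn big_ord_recr. Qed.

(** The ratio of consecutive terms is
    [d n * y / ((c + n) * (n + 1))], where [d n] grows at most as fast as [n]: it
    tends to [0].  The cases of use are [d n = b + n] for
    the confluent function and [d n = 1] for [0F1]. *)
Lemma hyp_abs_summable (b c y : C) (d : nat -> C) (f : nat -> C) :
  (forall n, pochn c n != 0) ->
  (forall n, `|d n| <= `|b| + 1 + n%:R) ->
  (forall n, f n.+1 = f n * (d n / (c + n%:R) * (y / n.+1%:R))) ->
  abs_summable f.
Proof.
move=> c_neq0 d_le fS.
have [K K_ge] : exists K : nat, `|(`|b| + 1 + `|c| + `|y| : C)| <= K%:R.
  exact: Cplx_archi.
have {}K_ge : `|b| + 1 + `|c| + `|y| <= K%:R.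
  by rewrite ger0_norm ?addr_ge0 in K_ge.
have bK : `|b| + 1 <= K%:R.
  by rewrite (le_trans _ K_ge) // -addrA lerDl addr_ge0.
have cK : `|c| <= K%:R by rewrite (le_trans _ K_ge) // addrAC lerDr !addr_ge0.
have yK : `|y| <= K%:R by rewrite (le_trans _ K_ge) // lerDr !addr_ge0.
(* If [4 * K <= n], then [2 * (n + K) * K <= (n - K) * (n + 1)].  This makes the
   ratio at most [1 / 2], since [|d n| <= n + K], [|y| <= K] and
   [n - K <= |c + n|]. *)
apply: (@ratio_abs_summable _ _ (4 * K)) => n Kn.
have K_le_n : (K <= n)%N by rewrite (leq_trans _ Kn) // leq_pmull.
have cn_ge : (n - K)%:R <= `|c + n%:R|.
  rewrite natrB // [c + _]addrC -[c]opprK (le_trans _ (lerB_dist _ _)) //.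
  by rewrite normrN normr_nat lerD2l lerN2.
have cn_neq0 : c + n%:R != 0.
  by have := c_neq0 n.+1; rewrite pochnS mulf_eq0 negb_or => /andP[].
rewrite fS normrM -mulrnAr ler_piMr // !normrM !normfV normr_nat.
rewrite mulrACA -mulr_natl -invfM mulrA ler_pdivrMr ?mul1r; last first.
  by rewrite mulr_gt0 ?normr_gt0 // ltr0n.
apply: (@le_trans _ _ (2 * ((n + K)%:R * K%:R))).
  rewrite ler_pM2l ?ltr0n // ler_pM // natrD [n%:R + _]addrC.
  by rewrite (le_trans (d_le n)) // lerD2r.
apply: (@le_trans _ _ ((n - K)%:R * n.+1%:R)); last by rewrite ler_wpM2r.
by rewrite -!natrM ler_nat; nia.
Qed.

Lemma Phi_abs_summable (b c y : C) : (forall n, pochn c n != 0) ->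
  abs_summable (fun n => pochn b n / pochn c n * (y ^+ n / n`!%:R)).
Proof.
move=> c_neq0; apply: (@hyp_abs_summable b c y (fun n => b + n%:R)) => // n.
  by rewrite (le_trans (ler_normD _ _)) // normr_nat -addrA lerD2l lerDr.
by rewrite !pochnS exprS factS natrM !invfM; ring.
Qed.

Lemma hyp0F1_abs_summable (c y : C) : (forall n, pochn c n != 0) ->
  abs_summable (fun n => y ^+ n / (pochn c n * n`!%:R)).
Proof.
move=> c_neq0; apply: (@hyp_abs_summable 0 c y (fun=> 1)) => // n.
  by rewrite normr0 normr1 add0r lerDl.
by rewrite !pochnS exprS factS natrM !invfM; ring.
Qed.

Lemma exp_abs_summable (y : C) : abs_summable (fun n => y ^+ n / n`!%:R).
Proof.
have p1 n : pochn (1 : C) n != 0.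
  by apply/prodf_neq0 => i _; rewrite addrC natr1 pnatr_eq0.
(* The exponential series is the confluent one with [b = c = 1]. *)
have := Phi_abs_summable 1 y p1; congr abs_summable.
by apply/funext => n; rewrite divff // mul1r.
Qed.

End ComplexNumbers.

(** * Interchanging a limit with an infinite sum *)

Section Tannery.
Variables (K : numFieldType) (I : choiceType) (B : nat -> {fset I}).
Hypothesis B_mono : forall L L', (L <= L')%N -> (B L `<=` B L')%fset.

(** Both limits are compared with [h L], the sum over [B L] of
    [g i * (e (n - d i) - l)], whose limit in [L] is [S n - G * l].  On a fixed
    [B L0] the factors [e (n - d i) - l] are small once [n] is large, and on the
    rest of [B L] they are bounded while the sum of [`|g i|] is small. *)
Lemma tannery (g : I -> K) (e : nat -> K) (d : I -> nat) (A G l : K)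
    (S : nat -> K) :
  e @ \oo --> l ->
  (fun L => \sum_(i <- B L) `|g i| : K) @ \oo --> A ->
  (fun L => \sum_(i <- B L) g i) @ \oo --> G ->
  (forall n, (fun L => \sum_(i <- B L) g i * e (n - d i)%N) @ \oo --> S n) ->
  S @ \oo --> G * l.
Proof.
move=> e_cvg gn_cvg g_cvg S_cvg.
set a := fun L : nat => _ in gn_cvg.
have [M M_gt0 e_le] : exists2 M : K, 0 < M & forall p, `|e p - l| <= M.
  have /cvg_seq_bounded/pinfty_ex_gt0[M M_gt0 e_le] : cvgn e.
    by apply/cvg_ex; exists l.
  exists (M + `|l|) => [|p]; first exact: ltr_wpDr.
  by rewrite (le_trans (ler_normB _ _)) // lerD2r e_le.
pose T : K := `|A| + 1.
have T_gt0 : 0 < T by rewrite ltr_wpDl.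
have D_gt0 : 0 < 1 + T + M *+ 2.
  by apply: addr_gt0; [apply: addr_gt0 | rewrite pmulrn_lgt0].
apply/cvgrPdist_le => eps eps_gt0.
(* The total error below is [del + (T * del + M * (2 * del))]. *)
pose del := eps / (1 + T + M *+ 2).
have del_gt0 : 0 < del by rewrite divr_gt0.
have [L0 _ a_near] : \forall L \near \oo, `|A - a L| <= 1 /\ `|A - a L| <= del.
  by apply: filterI; [move/cvgrPdist_le: gn_cvg => /(_ 1 ltr01)
                     |move/cvgrPdist_le: gn_cvg => /(_ del del_gt0)].
have [P _ e_near] : \forall p \near \oo, `|l - e p| <= del.
  by move/cvgrPdist_le: e_cvg => /(_ del del_gt0).
exists (P + \max_(i <- B L0) d i)%N => // n /= n_ge.
pose h L := \sum_(i <- B L) g i * (e (n - d i)%N - l).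
have h_cvg : h @ \oo --> S n - G * l.
  have -> : h = (fun L => \sum_(i <- B L) g i * e (n - d i)%N
                          - (\sum_(i <- B L) g i) * l).
    apply/funext => L; rewrite /h mulr_suml -sumrB.
    by apply: eq_bigr => i _; rewrite mulrBr.
  by apply: cvgB => //; apply: cvgMr_tmp.
have [L1 _ h_near] : \forall L \near \oo, `|S n - G * l - h L| <= del.
  by move/cvgrPdist_le: h_cvg => /(_ del del_gt0).
pose L := maxn L0 L1.
have L0_le : (L0 <= L)%N by rewrite leq_maxl.
have split_a : a L - a L0 = \sum_(i <- B L | i \notin B L0) `|g i|.
  rewrite /a [X in X - _](bigID (fun i => i \in B L0)) /=.
  suff -> : \sum_(i <- B L | i \in B L0) `|g i| = \sum_(i <- B L0) `|g i|.
    by rewrite addrAC subrr add0r.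
  rewrite -big_filter; apply: perm_big; apply: uniq_perm => [||i].
  - by rewrite filter_uniq ?fset_uniq.
  - exact: fset_uniq.
  rewrite mem_filter andb_idr // => i_in.
  by rewrite (fsubsetP (B_mono L0_le)).
have a_le : a L <= T.
  have [a_near1 _] := a_near L L0_le.
  rewrite -[a L]ger0_norm ?sumr_ge0 // -[X in `|X|](subKr A).
  by rewrite (le_trans (ler_normB _ _)) // lerD2l.
have tail_le : \sum_(i <- B L | i \notin B L0) `|g i| <= del *+ 2.
  rewrite -[X in X <= _]ger0_norm ?sumr_ge0 // -split_a.
  have [_ aL] := a_near L L0_le; have [_ aL0] := a_near L0 (leqnn _).
  have -> : a L - a L0 = (A - a L0) - (A - a L) by ring.
  by rewrite (le_trans (ler_normB _ _)) // mulr2n lerD.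
have h_le : `|h L| <= T * del + M * (del *+ 2).
  apply: (@le_trans _ _ (a L * del
            + M * \sum_(i <- B L | i \notin B L0) `|g i|)); last first.
    by apply: lerD; [rewrite ler_wpM2r // ltW | rewrite ler_wpM2l // ltW].
  rewrite /h (le_trans (ler_norm_sum _ _ _)) // mulr_suml mulr_sumr.
  rewrite [X in _ <= _ + X]big_mkcond -big_split /=.
  apply: ler_sum => i _; rewrite normrM.
  have [i_in|i_out] /= := boolP (i \in B L0).
    rewrite addr0 ler_wpM2l // distrC e_near //=.
    rewrite -(addnK (\max_(i <- B L0) d i) P) leq_sub //.
    exact: leq_bigmax_seq.
  rewrite [M * _]mulrC -mulrDr ler_wpM2l // (le_trans (e_le _)) //.
  by rewrite lerDr ltW.
rewrite distrC -[X in `|X|](subrK (h L)).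
rewrite (le_trans (ler_normD _ _)) //.
apply: (@le_trans _ _ (del + (T * del + M * (del *+ 2)))).
  by rewrite lerD // h_near //= leq_maxr.
rewrite -[X in _ <= X](mulfVK (lt0r_neq0 D_gt0)) -/del.
have -> : del * (1 + T + M *+ 2) = del + (T * del + M * (del *+ 2)) by ring.
exact: lexx.
Qed.

End Tannery.

(** * Sums over boxes of multi-indices *)

Section Boxes.
Variable r : nat.

Definition ffun_nat L (f : {ffun 'I_r -> 'I_L}) : {ffun 'I_r -> nat} :=
  [ffun i => val (f i)].

Definition box (L : nat) : {fset {ffun 'I_r -> nat}} :=
  [fset ffun_nat f | f in {: {ffun 'I_r -> 'I_L}}]%fset.

Lemma in_box L m : (m \in box L) = [forall i, m i < L]%N.
Proof.
apply/imfsetP/forallP => /= [[f _ ->] i|m_lt]; first by rewrite ffunE ltn_ord.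
exists [ffun i => Ordinal (m_lt i)] => //.
by apply/ffunP => i; rewrite !ffunE.
Qed.

Lemma box_mono L L' : (L <= L')%N -> (box L `<=` box L')%fset.
Proof.
move=> L_le; apply/fsubsetP => m; rewrite !in_box => /forallP m_lt.
by apply/forallP => i; apply: leq_trans L_le.
Qed.

(** A finite set of multi-indices lies in every large enough box, so a sum along
    the net of finite sets can be computed along the boxes. *)
Lemma box_cofinal : box @ \oo --> totally.
Proof.
move=> P [A _ A_P].
exists (\max_(m <- A) (\max_i m i).+1)%N => // L /= L_ge; apply: A_P => /=.
apply/fsubsetP => m m_in; rewrite in_box; apply/forallP => i.
apply: leq_trans L_ge; apply: leq_trans (leq_bigmax_seq _ m_in _) => //.
by rewrite ltnS leq_bigmax.
Qed.

Lemma sum_box_prod (K : comPzRingType) (F : 'I_r -> nat -> K) L :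
  \sum_(m <- box L) \prod_i F i (m i) = \prod_i \sum_(j < L) F i j.
Proof.
rewrite big_imfset /=; last first.
  move=> f g _ _ /ffunP fg; apply/ffunP => i; apply: val_inj.
  by have := fg i; rewrite !ffunE.
rewrite bigA_distr_bigA big_enum /=; apply: eq_bigr => f _.
by apply: eq_bigr => i _; rewrite ffunE.
Qed.

Lemma cvg_box (K : numFieldType) (F : {ffun 'I_r -> nat} -> K) (s : K) :
  partial_sum F @ totally --> s ->
  (fun L => \sum_(m <- box L) F m) @ \oo --> s.
Proof.
move=> F_cvg.
have -> : (fun L => \sum_(m <- box L) F m) = partial_sum F \o box.
  by apply/funext => L; rewrite big_seq_fsetE.
exact: cvg_comp box_cofinal F_cvg.
Qed.

End Boxes.

(** The interchange of limits for a multiple series whose terms split into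
    one-variable terms [f i (m i)], up to factors [e (n - d m)] coming from the
    sum over [j]. *)
Lemma generating_series_cvg (K : numFieldType) r (f : 'I_r -> nat -> K)
    (F A : 'I_r -> K) (e : nat -> K) (l : K) (d : {ffun 'I_r -> nat} -> nat)
    (T : nat -> {ffun 'I_r -> nat} -> K) (S w : nat -> K) :
  (forall i, series (f i) @ \oo --> F i) ->
  (forall i, series (fun j => `|f i j| : K) @ \oo --> A i) ->
  e @ \oo --> l ->
  (forall n, partial_sum (T n) @ totally --> S n) ->
  (forall n m, \sum_(j < n) T j m * w j
               = \prod_i f i (m i) * e (n - d m)%N) ->
  series (fun n => S n * w n) @ \oo --> \prod_i F i * l.
Proof.
move=> F_cvg A_cvg e_cvg S_cvg T_sum.
have prod_cvg (u : 'I_r -> nat -> K) (v : 'I_r -> K) :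
    (forall i, series (u i) @ \oo --> v i) ->
    (fun L => \sum_(m <- box r L) \prod_i u i (m i)) @ \oo --> \prod_i v i.
  move=> u_cvg.
  have -> : (fun L => \sum_(m <- box r L) \prod_i u i (m i))
            = (fun L => \prod_i series (u i) L).
    apply/funext => L; rewrite sum_box_prod; apply: eq_bigr => i _.
    by rewrite /series /= big_mkord.
  by apply: cvg_big => [|i _]; [exact: mul_continuous | exact: u_cvg].
apply: (tannery (@box_mono r) (d := d) e_cvg _ (prod_cvg f F F_cvg)).
  have := prod_cvg _ _ A_cvg.
  under eq_fun do under eq_bigr do rewrite -normr_prod.
  exact.
move=> n.
have -> : (fun L => \sum_(m <- box r L) \prod_i f i (m i) * e (n - d m)%N)
          = (fun L => \sum_(j < n) (\sum_(m <- box r L) T j m) * w j).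
  apply/funext => L.
  under [RHS]eq_bigr do rewrite mulr_suml.
  rewrite exchange_big; apply: eq_bigr => m _.
  by rewrite T_sum.
rewrite /series /= big_mkord.
apply: cvg_big => [|j _]; first exact: add_continuous.
by apply: cvgMr_tmp; apply: cvg_box.
Qed.

(** * The Pochhammer symbol at a nonpositive integer *)

(** For [n < N] the product contains the factor [- n + n]. *)
Lemma prod_opp_nat_fact (K : numFieldType) (n N : nat) :
  \prod_(j < N) (- n%:R + j%:R) / n`!%:R
  = if (N <= n)%N then (- 1) ^+ N / (n - N)`!%:R else 0 :> K.
Proof.
elim: N => [|N IHN]; first by rewrite subn0 big_ord0 mul1r.
rewrite big_ord_recr /= mulrAC IHN; have [N_lt|n_le] := ltnP N n; last first.
  case: ltngtP n_le => // [_|->] _; first by rewrite mul0r.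
  by rewrite addNr mulr0.
have -> : - n%:R + N%:R = - (n - N)%:R :> K.
  by rewrite natrB ?(ltnW N_lt) // opprB addrC.
rewrite (ltnW N_lt) exprS -(subnSK N_lt) factS natrM.
by field; rewrite addrC natr1 !pnatr_eq0 -lt0n fact_gt0.
Qed.

(** Only the indices [j >= N] contribute, and shifting them by [N] leaves a
    partial sum of the exponential series. *)
Lemma sum_opp_nat_poch (K : numFieldType) (t : K) n N :
  \sum_(j < n) (\prod_(i < N) (- j%:R + i%:R)) * (t ^+ j / j`!%:R)
  = (- t) ^+ N * series (fun j => t ^+ j / j`!%:R) (n - N)%N.
Proof.
transitivity (\sum_(0 <= j < n | (N <= j)%N)
                 (- t) ^+ N * (t ^+ (j - N) / (j - N)`!%:R)).
  rewrite big_mkord [RHS]big_mkcond; apply: eq_bigr => j _.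
  rewrite mulrCA prod_opp_nat_fact; case: leqP => N_le; last by rewrite mulr0.
  by rewrite -{1}(subnKC N_le) exprD [(- t) ^+ N]exprNn; ring.
rewrite /series /= mulr_sumr.
have [N_le|n_lt] := leqP N n; last first.
  rewrite (eqP (ltnW n_lt)) [RHS]big_geq // big_nat_cond big1 //.
  move=> j /andP[/andP[_ j_lt] N_le].
  by have := leq_ltn_trans N_le j_lt; rewrite ltnNge ltnW.
rewrite (big_cat_nat (leq0n N) N_le) //= big_nat_cond big1 ?add0r; last first.
  by move=> j /andP[/andP[_ j_lt]]; rewrite leqNgt j_lt.
rewrite big_nat_cond (eq_bigl (fun j => N <= j < n)%N); last first.
  by move=> j; rewrite andb_idr // => /andP[].
rewrite -big_nat -{1}(add0n N) big_addn.
by apply: eq_bigr => j _; rewrite addnK.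
Qed.

(** * Factorization of the terms of the multiple series *)

Section Exponent.
Variables (R : realType) (r k : nat) (rho : R).

(** The exponent of [- t] contributed by the index [n] of the [i]-th variable.
    It is used only when [rho] is a natural number or no [i] is less than [k], so
    that the truncation loses nothing. *)
Definition weight (i : 'I_r) (n : nat) : nat :=
  if (i < k)%N then (Num.truncn rho * n)%N else n.

Lemma E_exponent_nat (m : {ffun 'I_r -> nat}) :
  (forall i : 'I_r, (i < k)%N -> rho \is a Num.nat) ->
  E_exponent rho k m = (\sum_i weight i (m i))%:R.
Proof.
move=> rho_nat.
rewrite /E_exponent [in RHS](bigID (fun i : 'I_r => i < k)%N) /= natrD; congr (_ + _).
  rewrite !natr_sum mulr_sumr; apply: eq_bigr => i i_lt.
  by rewrite /weight i_lt natrM truncnK // (rho_nat i).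
rewrite !natr_sum; apply: eq_big => i; first by rewrite leqNgt.
by rewrite /weight leqNgt => /negbTE ->.
Qed.

Lemma poch_defined_opp_nat (n : nat) (nu : R) :
  poch_defined (- n%:R) nu -> nu \is a Num.nat.
Proof. by case=> // -[/(_ n)]. Qed.

(** The exponent of the multi-index which is [1] at [i] and [0] elsewhere is
    [rho]. *)
Lemma E_defined_rho_nat (beta gamma x : 'I_r -> Cplx R) :
  E_defined rho k (- 0%:R) beta gamma x ->
  forall i : 'I_r, (i < k)%N -> rho \is a Num.nat.
Proof.
case=> E_poch _ _ _ i i_lt.
have /poch_defined_opp_nat := E_poch [ffun j => (j == i : nat)].
rewrite /E_exponent (bigD1 i) //= ffunE eqxx big1; last first.
  by move=> j /andP[_ /negbTE ji]; rewrite ffunE ji.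
rewrite big1 ?addr0 ?mulr1 // => j k_le; rewrite ffunE; case: eqP => // ji.
by rewrite ji leqNgt i_lt in k_le.
Qed.

End Exponent.

Section Factors.
Variables (R : realType) (r k : nat) (rho : R).
Variables (beta gamma x : 'I_r -> Cplx R) (t : Cplx R).
Notation C := (Cplx R).

(** The [n]-th term of the [i]-th one-variable series on the right-hand side. *)
Definition factor (i : 'I_r) (n : nat) : C :=
  if (i < k)%N then (x i * powC (- t) rho) ^+ n / (pochn (gamma i) n * n`!%:R)
  else pochn (beta i) n / pochn (gamma i) n * ((- x i * t) ^+ n / n`!%:R).

Hypothesis rho_nat : forall i : 'I_r, (i < k)%N -> rho \is a Num.nat.

Lemma factorE i n :
  factor i n = (- t) ^+ weight k rho i n
    * ((if (k <= i)%N then pochn (beta i) n else 1) / pochn (gamma i) n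
       * (x i ^+ n / n`!%:R)).
Proof.
have eq0F1 (K : fieldType) (y s g : K) p N :
    (y * s ^+ p) ^+ n / (g * N) = s ^+ (p * n) * (1 / g * (y ^+ n / N)).
  by rewrite exprMn -exprM invfM; ring.
have eqPhi (K : fieldType) (y s b g : K) N :
    b / g * ((- y * s) ^+ n / N) = (- s) ^+ n * (b / g * (y ^+ n / N)).
  by rewrite mulNr -mulrN exprMn; ring.
rewrite /factor /weight; case: ltnP => [i_lt|k_le].
  by rewrite /powC (rho_nat i_lt) eq0F1.
exact: eqPhi.
Qed.

(** With [d] the exponent of [m], the term of [m] is [(-j)_d * Q], where [Q]
    does not depend on [j], and the product of the factors is [(- t)^d * Q]. *)
Lemma sum_E_term (m : {ffun 'I_r -> nat}) n :
  \sum_(j < n) E_term rho k (- j%:R) beta gamma x m * (t ^+ j / j`!%:R)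
  = \prod_i factor i (m i)
    * series (fun j => t ^+ j / j`!%:R : C)
        (n - \sum_i weight k rho i (m i))%N.
Proof.
set d := (\sum_i _)%N.
under [in RHS]eq_bigr do rewrite factorE.
rewrite !big_split /= prodfV -expr_sum -/d -big_mkcond /=.
set Q := _ / _ * _.
rewrite mulrAC -sum_opp_nat_poch mulr_suml; apply: eq_bigr => j _.
rewrite /E_term E_exponent_nat // /poch natr_nat natrK -/d big_split /=.
rewrite -[X in X * _]mulrA -/Q; exact: mulrAC.
Qed.

End Factors.

(** * The generating function *)

Theorem theorem3 (R : realType) (r k : nat) (rho : R)
    (beta gamma x : 'I_r -> Cplx R) (t : Cplx R)
    (r_gt0 : (1 <= r)%N) (k_le_r : (k <= r)%N) (rho_ge0 : 0 <= rho)
    (t_lt1 : `|t| < 1)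
    (E_def : forall n : nat, E_defined rho k (- n%:R) beta gamma x) :
  series (fun n : nat =>
    E_fun rho k (- n%:R) beta gamma x * (t ^+ n / n`!%:R) : Cplx R) @ \oo -->
  expC t
  * \prod_(i < r | (i < k)%N) hyp0F1 (gamma i) (x i * powC (- t) rho)
  * \prod_(i < r | (k <= i)%N) Phi (beta i) (gamma i) (- x i * t).
Proof.
have rho_nat := E_defined_rho_nat (E_def 0%N).
have gamma_neq0 i n : pochn (gamma i) n != 0 by case: (E_def 0%N).
have complete := @Cplx_monotone_complete R.
pose f := factor k rho beta gamma x t.
have f_sum i : abs_summable (f i).
  rewrite /f /factor; case: (i < k)%N.
    exact: hyp0F1_abs_summable.
  exact: Phi_abs_summable.
have -> : expC t
  * \prod_(i < r | (i < k)%N) hyp0F1 (gamma i) (x i * powC (- t) rho)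
  * \prod_(i < r | (k <= i)%N) Phi (beta i) (gamma i) (- x i * t)
  = \prod_i limn (series (f i)) * expC t.
  rewrite [in RHS](bigID (fun i : 'I_r => i < k)%N) /=.
  rewrite -mulrA [RHS]mulrC; congr (_ * (_ * _)).
    by apply: eq_bigr => i i_lt; rewrite /f /factor i_lt.
  apply: eq_big => i; first by rewrite leqNgt.
  by rewrite leqNgt /f /factor => /negbTE ->.
apply: (generating_series_cvg (f := f)
  (A := fun i => limn (series (fun j => `|f i j| : Cplx R)))
  (d := fun m => (\sum_i weight k rho i (m i))%N)) => [i|i||n|n m].
- exact: abs_summable_cvg.
- exact: abs_summable_norm_cvg.
- exact: abs_summable_cvg (exp_abs_summable t).
- by have [_ _ _ E_cvg] := E_def n; exact: E_cvg.
- exact: sum_E_term.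
Qed.
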